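(* Among the six families (F1)–(F6) of $5$-dimensional Lie algebras listed in the context, endowed with the hypo-contact structure $$\eta=e^5,\quad \omega_1=e^{12}+e^{34},\quad \omega_2=e^{13}+e^{42},\quad \omega_3=e^{14}+e^{23},$$ the family (F2) and the Lie algebra in (F4) with $a=b=0$ are the only ones which are $\eta$-Einstein.
   Context: Write $e^{ij}=e^i\wedge e^j$; $e^1,\dots,e^5$ is a basis of the dual of the Lie algebra $\mathfrak g$, orthonormal for the metric $g=\sum_i(e^i)^2$ associated to the hypo-contact structure, and $d$ is the Chevalley–Eilenberg differential ($d\alpha(X,Y)=-\alpha([X,Y])$). In all families $de^1=0$ and $de^5=-2e^{14}-2e^{23}$; the remaining structure equations are: (F1) ($r\in\mathbb R\setminus\{0\}$): $de^2=re^{12}$, $de^3=re^{13}$, $de^4=-re^{14}-3r^2e^{15}+2re^{23}$. (F2) ($r\in\mathbb R\setminus\{0\}$): $de^2=re^{12}+3re^{34}+3r^2e^{35}$, $de^3=re^{13}-3re^{24}-3r^2e^{25}$, $de^4=-r\,de^5$. (F3) ($a\in\mathbb R$, $r\in\mathbb R\setminus\{0\}$): $de^2=re^{14}-re^{23}-are^{25}+r^2e^{35}$, $de^3=\frac ar\,de^2$, $de^4=re^{12}+ae^{13}-(a^2+r^2)e^{15}+ae^{24}-re^{34}$. (F4) ($a,b\in\mathbb R$): $de^2=0$, $de^3=ae^{13}+be^{14}-be^{23}+ae^{24}-(a^2+b^2)e^{25}$, $de^4=be^{13}-ae^{14}-(a^2+b^2)e^{15}+ae^{23}+be^{24}$.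 (F5) ($r\in\mathbb R\setminus\{0\}$): $de^2=re^{34}+\frac{r^2}2e^{35}$, $de^3=re^{13}$, $de^4=-\frac{r^2}2e^{15}+re^{23}$. (F6) ($a\in\mathbb R$, $r\in\mathbb R\setminus\{0\}$): $de^2=re^{12}+ae^{13}+ae^{24}+\frac a{2r}(r^2+a^2)e^{25}+\frac{a^2}re^{34}+\frac{a^2}{2r^2}(r^2+a^2)e^{35}$, $de^3=ae^{12}+\frac{a^2}re^{13}-re^{24}-\frac12(r^2+a^2)e^{25}-ae^{34}-\frac a{2r}(r^2+a^2)e^{35}$, $de^4=-\frac{(r^2+a^2)^2}{2r^2}e^{15}+\frac{r^2+a^2}re^{23}$. A structure with contact form $\eta$ and associated metric $g$ is $\eta$-Einstein if there are functions $\tau,\nu$ (constants in the present left-invariant setting) such that $\mathrm{Ric}(X,Y)=\tau\,g(X,Y)+\nu\,\eta(X)\eta(Y)$ for all $X,Y$, where $\mathrm{Ric}$ is the Ricci tensor of the left-invariant metric $g$. *)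

(* Defs.v *)
From mathcomp Require Import all_boot all_order all_algebra ring.
From mathcomp Require Import boolp functions reals.

Set Implicit Arguments.
Unset Strict Implicit.
Unset Printing Implicit Defensive.

Import GRing.Theory.
Local Open Scope ring_scope.

(* The Lie algebra is carried by R^5 with an arbitrary Lie bracket.  The values
   of a form are typed R^o so that forms inherit the pointwise R-module
   structure of functions and structure equations are equalities of 2-forms. *)
Notation vec R := 'rV[R]_5.
Notation one_form R := (vec R -> R^o).
Notation two_form R := (vec R -> vec R -> R^o).

Definition lie_bracket (R : realType) (br : vec R -> vec R -> vec R) : Prop :=
  [/\ forall a X Y Z, br (a *: X + Y) Z = a *: br X Z + br Y Z,
      forall a X Y Z, br X (a *: Y + Z) = a *: br X Y + br X Z,
      forall X, br X X = 0 &
      forall X Y Z, br X (br Y Z) + br Y (br Z X) + br Z (br X Y) = 0].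

(* A basis e^1, ..., e^5 of the dual is an invertible matrix P, whose i-th
   column is the coordinate vector of e^i; the index is 1-based. *)
Definition coframe (R : realType) (P : 'M[R]_5) (i : nat) : one_form R :=
  fun X => (X *m P) 0 (inord i.-1).

Definition wedge (R : realType) (al be : one_form R) : two_form R :=
  fun X Y => al X * be Y - al Y * be X.

(* e^{ij} *)
Definition ee (R : realType) (P : 'M[R]_5) (i j : nat) : two_form R :=
  wedge (coframe P i) (coframe P j).

(* Chevalley-Eilenberg differential on 1-forms *)
Definition CEd (R : realType) (br : vec R -> vec R -> vec R) (al : one_form R) :
    two_form R :=
  fun X Y => - al (br X Y).

Inductive hypo_family (R : realType) : Type :=
| F1 of R
| F2 of R
| F3 of R & R
| F4 of R & R
| F5 of R
| F6 of R & R.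

(* Parameters are listed as F1 r, F2 r, F3 a r, F4 a b, F5 r, F6 a r. *)
Definition admissible (R : realType) (F : hypo_family R) : Prop :=
  match F with
  | F1 r | F2 r | F3 _ r | F5 r | F6 _ r => r != 0
  | F4 _ _ => True
  end.

Definition structure_equations (R : realType) (br : vec R -> vec R -> vec R)
    (P : 'M[R]_5) (F : hypo_family R) : Prop :=
  let de (i : nat) := CEd br (coframe P i) in
  [/\ de 1%N = 0,
      de 5%N = - 2 *: ee P 1 4 - 2 *: ee P 2 3 &
      match F with
      | F1 r =>
        [/\ de 2%N = r *: ee P 1 2,
            de 3%N = r *: ee P 1 3 &
            de 4%N = - r *: ee P 1 4 - (3 * r ^+ 2) *: ee P 1 5
                     + (2 * r) *: ee P 2 3]
      | F2 r =>
        [/\ de 2%N = r *: ee P 1 2 + (3 * r) *: ee P 3 4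
                     + (3 * r ^+ 2) *: ee P 3 5,
            de 3%N = r *: ee P 1 3 - (3 * r) *: ee P 2 4
                     - (3 * r ^+ 2) *: ee P 2 5 &
            de 4%N = - r *: de 5%N]
      | F3 a r =>
        [/\ de 2%N = r *: ee P 1 4 - r *: ee P 2 3 - (a * r) *: ee P 2 5
                     + r ^+ 2 *: ee P 3 5,
            de 3%N = (a / r) *: de 2%N &
            de 4%N = r *: ee P 1 2 + a *: ee P 1 3
                     - (a ^+ 2 + r ^+ 2) *: ee P 1 5
                     + a *: ee P 2 4 - r *: ee P 3 4]
      | F4 a b =>
        [/\ de 2%N = 0,
            de 3%N = a *: ee P 1 3 + b *: ee P 1 4 - b *: ee P 2 3
                     + a *: ee P 2 4 - (a ^+ 2 + b ^+ 2) *: ee P 2 5 &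
            de 4%N = b *: ee P 1 3 - a *: ee P 1 4
                     - (a ^+ 2 + b ^+ 2) *: ee P 1 5
                     + a *: ee P 2 3 + b *: ee P 2 4]
      | F5 r =>
        [/\ de 2%N = r *: ee P 3 4 + (r ^+ 2 / 2) *: ee P 3 5,
            de 3%N = r *: ee P 1 3 &
            de 4%N = - (r ^+ 2 / 2) *: ee P 1 5 + r *: ee P 2 3]
      | F6 a r =>
        [/\ de 2%N = r *: ee P 1 2 + a *: ee P 1 3 + a *: ee P 2 4
                     + (a / (2 * r) * (r ^+ 2 + a ^+ 2)) *: ee P 2 5
                     + (a ^+ 2 / r) *: ee P 3 4
                     + (a ^+ 2 / (2 * r ^+ 2) * (r ^+ 2 + a ^+ 2)) *: ee P 3 5,
            de 3%N = a *: ee P 1 2 + (a ^+ 2 / r) *: ee P 1 3 - r *: ee P 2 4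
                     - (2^-1 * (r ^+ 2 + a ^+ 2)) *: ee P 2 5
                     - a *: ee P 3 4
                     - (a / (2 * r) * (r ^+ 2 + a ^+ 2)) *: ee P 3 5 &
            de 4%N = - ((r ^+ 2 + a ^+ 2) ^+ 2 / (2 * r ^+ 2)) *: ee P 1 5
                     + ((r ^+ 2 + a ^+ 2) / r) *: ee P 2 3]
      end].

(* The forms (eta, omega_1, omega_2, omega_3) of an SU(2)-structure *)
Record su2_forms (R : realType) := Su2Forms {
  eta : one_form R;
  omega1 : two_form R;
  omega2 : two_form R;
  omega3 : two_form R }.

Definition adapted_forms (R : realType) (P : 'M[R]_5) : su2_forms R :=
  {| eta := coframe P 5;
     omega1 := ee P 1 2 + ee P 3 4;
     omega2 := ee P 1 3 + ee P 4 2;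
     omega3 := ee P 1 4 + ee P 2 3 |}.

Definition is_su2_structure (R : realType) (S : su2_forms R) : Prop :=
  exists2 P : 'M[R]_5, P \in unitmx & S = adapted_forms P.

(* The metric associated to S is the one for which adapted coframes are
   orthonormal; it does not depend on the adapted coframe since the stabiliser
   SU(2) of S is contained in SO(5). *)
Definition associated_metric (R : realType) (S : su2_forms R)
    (g : two_form R) : Prop :=
  exists P : 'M[R]_5,
    [/\ P \in unitmx, S = adapted_forms P &
        forall X Y, g X Y = \sum_(1 <= i < 6) coframe P i X * coframe P i Y].

Definition wedge12 (R : realType) (al : one_form R) (om : two_form R)
    (X Y Z : vec R) : R :=
  al X * om Y Z + al Y * om Z X + al Z * om X Y.

(* Chevalley-Eilenberg differential on 3-forms *)
Definition CEd3 (R : realType) (br : vec R -> vec R -> vec R)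
    (th : vec R -> vec R -> vec R -> R) (X Y Z W : vec R) : R :=
  - th (br X Y) Z W + th (br X Z) Y W - th (br X W) Y Z
  - th (br Y Z) X W + th (br Y W) X Z - th (br Z W) X Y.

Definition hypo_contact (R : realType) (br : vec R -> vec R -> vec R)
    (S : su2_forms R) : Prop :=
  [/\ is_su2_structure S,
      CEd br (eta S) = - 2 *: omega3 S,
      forall X Y Z W, CEd3 br (wedge12 (eta S) (omega1 S)) X Y Z W = 0 &
      forall X Y Z W, CEd3 br (wedge12 (eta S) (omega2 S)) X Y Z W = 0].

(* Levi-Civita connection of a left-invariant metric, restricted to
   left-invariant vector fields; g X Y is then constant on the group, so that
   nabla g = 0 has no derivative term. *)
Definition levi_civita (R : realType) (br : vec R -> vec R -> vec R)
    (g : two_form R) (nabla : vec R -> vec R -> vec R) : Prop :=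
  [/\ forall a X Y Z, nabla (a *: X + Y) Z = a *: nabla X Z + nabla Y Z,
      forall a X Y Z, nabla X (a *: Y + Z) = a *: nabla X Y + nabla X Z,
      forall X Y, nabla X Y - nabla Y X = br X Y &
      forall X Y Z, g (nabla X Y) Z + g Y (nabla X Z) = 0].

Definition curvature (R : realType) (br nabla : vec R -> vec R -> vec R)
    (X Y Z : vec R) : vec R :=
  nabla X (nabla Y Z) - nabla Y (nabla X Z) - nabla (br X Y) Z.

(* Ric(X, Y) = trace of Z |-> Rm(Z, X) Y *)
Definition ricci (R : realType) (br nabla : vec R -> vec R -> vec R)
    (X Y : vec R) : R :=
  \tr (lin1_mx (fun Z => curvature br nabla Z X Y)).

Definition eta_einstein (R : realType) (br : vec R -> vec R -> vec R)
    (S : su2_forms R) : Prop :=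
  exists (g : two_form R) (nabla : vec R -> vec R -> vec R),
    [/\ associated_metric S g, levi_civita br g nabla &
        exists tau nu : R, forall X Y,
          ricci br nabla X Y = tau * g X Y + nu * (eta S X * eta S Y)].

(* The six families are Lie algebras, and the forms above define hypo-contact
   structures on them. *)

Lemma coframe_bracket (R : realType) (br : vec R -> vec R -> vec R)
    (P : 'M[R]_5) (w : two_form R) (i : nat) :
  CEd br (coframe P i) = w ->
  forall X Y, coframe P i (br X Y) = - (w X Y : R).
Proof. by move=> <- X Y; rewrite /CEd opprK. Qed.

Lemma two_formE (R : realType) (P : 'M[R]_5) :
  ((forall X Y, (0 : two_form R) X Y = 0 :> R) *
   (forall (v w : two_form R) X Y,
      ((v + w : two_form R) X Y = (v X Y : R) + w X Y :> R)%R) *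
   (forall (w : two_form R) X Y,
      ((- w : two_form R) X Y = - (w X Y : R) :> R)%R) *
   (forall (c : R) (w : two_form R) X Y,
      ((c *: w : two_form R) X Y = c * (w X Y : R) :> R)%R) *
   (forall i j X Y,
      (ee P i j X Y =
       coframe P i X * coframe P j Y - coframe P i Y * coframe P j X :> R)%R))%type.
Proof. by []. Qed.

Lemma coframe_linear (R : realType) (P : 'M[R]_5) (i : nat) :
  ((coframe P i 0 = 0 :> R) *
   (forall X Y : vec R,
      (coframe P i (X + Y) = (coframe P i X : R) + coframe P i Y :> R)%R) *
   (forall (a : R) (X : vec R),
      (coframe P i (a *: X) = a * (coframe P i X : R) :> R)%R))%type.
Proof.
by split=> [|a X]; first split=> [|X Y];
  rewrite /coframe ?mul0mx ?mulmxDl -?scalemxAl mxE.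
Qed.

Lemma coframe_inj (R : realType) (P : 'M[R]_5) (X Y : vec R) :
  P \in unitmx ->
  [/\ coframe P 1 X = coframe P 1 Y, coframe P 2 X = coframe P 2 Y,
      coframe P 3 X = coframe P 3 Y, coframe P 4 X = coframe P 4 Y &
      coframe P 5 X = coframe P 5 Y] -> X = Y.
Proof.
move=> uP [h1 h2 h3 h4 h5]; apply: (can_inj (mulmxK uP)).
apply/rowP=> i; rewrite -[i]inord_val.
by case: i => [[|[|[|[|[|]]]]] ?].
Qed.

Lemma bracket_of_forms (R : realType) (P : 'M[R]_5) (w1 w2 w3 w4 w5 : two_form R) :
  P \in unitmx ->
  exists br : vec R -> vec R -> vec R,
    [/\ CEd br (coframe P 1) = w1, CEd br (coframe P 2) = w2,
        CEd br (coframe P 3) = w3, CEd br (coframe P 4) = w4 &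
        CEd br (coframe P 5) = w5].
Proof.
move=> uP.
exists (fun X Y => (\row_(k < 5) - (nth 0 [:: w1; w2; w3; w4; w5] k X Y : R))
                     *m invmx P).
by split; apply/funext => X; apply/funext => Y;
  rewrite /CEd /coframe mulmxKV // mxE inordK // opprK.
Qed.

Ltac expand_bracket P E :=
  let E' := fresh in
  match type of E with CEd ?br (coframe P ?i) = _ =>
    let f := open_constr:(_) in
    assert (E' : forall X Y, coframe P i (br X Y) = f X Y)
  end;
  [ let X := fresh in let Y := fresh in let H := fresh in
    intros X Y; have H := coframe_bracket E X Y;
    rewrite !(two_formE P) in H; exact H
  | cbv beta in E'; clear E; rename E' into E ].

Ltac generalize_coframe R P :=
  repeat match goal with
  | |- context [coframe P ?i ?X] => generalize (coframe P i X : R); intro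
  end.

Lemma exists_lie_bracket (R : realType) (P : 'M[R]_5) (F : hypo_family R) :
  P \in unitmx -> admissible F ->
  exists br : vec R -> vec R -> vec R,
    lie_bracket br /\ structure_equations br P F.
Proof.
move=> uP; case: F => [r|r|a r|a b|r|a r] /= adm;
  edestruct (@bracket_of_forms R P) as [br [E1 E2 E3 E4 E5]];
  try exact: uP; exists br;
  (split; last by split; [exact: E1 | exact: E5 |
     split; [exact: E2 | rewrite ?E2; exact: E3 | rewrite ?E5; exact: E4]]);
  expand_bracket P E1; expand_bracket P E2; expand_bracket P E3;
  expand_bracket P E4; expand_bracket P E5;
  split=> *; apply: (coframe_inj uP); split;
  rewrite ?coframe_linear ?(E1, E2, E3, E4, E5) ?coframe_linear
    ?(E1, E2, E3, E4, E5);
  generalize_coframe R P; by field.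
Qed.

Lemma adapted_hypo_contact (R : realType) (br : vec R -> vec R -> vec R)
    (P : 'M[R]_5) (F : hypo_family R) :
  P \in unitmx -> admissible F -> structure_equations br P F ->
  hypo_contact br (adapted_forms P).
Proof.
move=> uP adm [] E1 E5 EF; split; first by exists P.
- rewrite /= E5; apply/funext => X; apply/funext => Y.
  by rewrite !(two_formE P); ring.
- move=> X Y Z W; rewrite /CEd3 /wedge12 /= !(two_formE P).
  by case: F adm EF => [r|r|a r|a b|r|a r] /= adm [] E2 E3 E4;
    rewrite ?E2 ?E5 in E3 E4;
    expand_bracket P E1; expand_bracket P E2; expand_bracket P E3;
    expand_bracket P E4; expand_bracket P E5;
    rewrite !E1 !E2 !E3 !E4 !E5; generalize_coframe R P; field.
- move=> X Y Z W; rewrite /CEd3 /wedge12 /= !(two_formE P).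
  by case: F adm EF => [r|r|a r|a b|r|a r] /= adm [] E2 E3 E4;
    rewrite ?E2 ?E5 in E3 E4;
    expand_bracket P E1; expand_bracket P E2; expand_bracket P E3;
    expand_bracket P E4; expand_bracket P E5;
    rewrite !E1 !E2 !E3 !E4 !E5; generalize_coframe R P; field.
Qed.

(* Main.v *)
(* In an adapted coframe the Ricci tensor of a left-invariant metric is a
   polynomial in the structure constants, by Koszul's formula.  Since
   eta = e^5, an eta-Einstein structure satisfies Ric(e_1, e_1) = Ric(e_4, e_4);
   in every family but (F2) the difference of these two entries is a combination
   of squares with nonnegative coefficients, which vanishes only for (F4) with
   a = b = 0.  Conversely (F2) has Ric = -(2 + 6 r^2) g + (6 + 6 r^2) eta^2, also
   at r = 0, where its structure equations are those of (F4) with a = b = 0. *)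
From HB Require Import structures.
Require Import Defs.
From mathcomp Require Import all_boot all_order all_algebra ring lra.
From mathcomp Require Import boolp functions reals.

Set Implicit Arguments.
Unset Strict Implicit.
Unset Printing Implicit Defensive.

Import Order.TTheory GRing.Theory Num.Theory.
Local Open Scope ring_scope.

(** * Dual frames, traces and the metric in which a coframe is orthonormal *)

Section Frame.
Variables (R : realType) (P : 'M[R]_5).
Hypothesis uP : P \in unitmx.

(** The basis dual to the coframe: the columns of [P] are the [e^i], so the rows of its inverse are
    the [e_i]. *)
Definition frame (i : nat) : vec R := row (inord i.-1) (invmx P).

Lemma coframe_frame i j :
  (0 < i < 6)%N -> (0 < j < 6)%N -> coframe P i (frame j) = (i == j)%:R :> R.
Proof.
case: i j => [//|i] [//|j] /= i5 j5.
rewrite /coframe /frame -row_mul mulVmx // !mxE -val_eqE /= !inordK //.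
by rewrite eqSS eq_sym.
Qed.

Lemma sum_frame (X : vec R) : X = \sum_(1 <= i < 6) (coframe P i X : R) *: frame i.
Proof.
rewrite -[LHS](mulmxK uP) mulmx_sum_row big_add1 big_mkord.
by apply: eq_bigr => i _; rewrite /coframe /frame /= inord_val.
Qed.

Lemma linear_frame (V : lmodType R) (f : vec R -> V) (X : vec R) :
  linear f -> f X = \sum_(1 <= i < 6) (coframe P i X : R) *: f (frame i).
Proof.
move=> flin; pose F : {linear vec R -> V} :=
  HB.pack f (GRing.isLinear.Build R (vec R) V *:%R f flin).
rewrite -[f]/(F : vec R -> V) {1}[X]sum_frame linear_sum.
by apply: eq_bigr => i _; rewrite linearZ.
Qed.

Lemma linear_frame_eq (V : lmodType R) (f h : vec R -> V) :
  linear f -> linear h ->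
  (forall i, (0 < i < 6)%N -> f (frame i) = h (frame i)) -> f =1 h.
Proof.
move=> flin hlin fh X; rewrite (linear_frame X flin) (linear_frame X hlin).
rewrite big_seq [RHS]big_seq; apply: eq_bigr => i.
by rewrite mem_index_iota => /fh ->.
Qed.

Lemma trace_frame (f : vec R -> vec R) :
  linear f -> \tr (lin1_mx f) = \sum_(1 <= i < 6) (coframe P i (f (frame i)) : R).
Proof.
move=> flin; pose F : {linear vec R -> vec R} :=
  HB.pack f (GRing.isLinear.Build R (vec R) (vec R) *:%R f flin).
(* The trace is invariant under conjugation by [P], and the diagonal of the conjugate holds the
   wanted coordinates. *)
rewrite -[f]/(F : vec R -> vec R) -[lin1_mx F](mulmxK uP) mxtrace_mulC.
rewrite big_add1 big_mkord; apply: eq_bigr => i _.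
rewrite /coframe /frame /= inord_val -[f _]/(F _) -(mul_rV_lin1 F).
by rewrite -!row_mul [RHS]mxE mulmxA.
Qed.

Definition frame_metric (X Y : vec R) : R :=
  \sum_(1 <= i < 6) coframe P i X * coframe P i Y.

Lemma frame_metricC X Y : frame_metric X Y = frame_metric Y X.
Proof. by apply: eq_bigr => i _; rewrite mulrC. Qed.

Lemma frame_metricDl a X Y Z :
  frame_metric (a *: X + Y) Z = a * frame_metric X Z + frame_metric Y Z.
Proof.
rewrite mulr_sumr -big_split /=; apply: eq_bigr => i _.
by rewrite !coframe_linear; ring.
Qed.

Lemma frame_metricDr a X Y Z :
  frame_metric X (a *: Y + Z) = a * frame_metric X Y + frame_metric X Z.
Proof. by rewrite !(frame_metricC X) frame_metricDl. Qed.

Lemma frame_metricBl X Y Z :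
  frame_metric (X - Y) Z = frame_metric X Z - frame_metric Y Z.
Proof. by rewrite addrC -scaleN1r frame_metricDl; ring. Qed.

Lemma frame_metricNl X Y : frame_metric (- X) Y = - frame_metric X Y.
Proof. by rewrite -[X]subr0 opprB !frame_metricBl; ring. Qed.

Lemma frame_metric_frame X k :
  (0 < k < 6)%N -> frame_metric X (frame k) = coframe P k X.
Proof.
move=> k6; rewrite /frame_metric (bigD1_seq k) ?iota_uniq ?mem_index_iota //=.
rewrite coframe_frame // eqxx mulr1 big_seq_cond big1 ?addr0 // => i.
rewrite mem_index_iota => /andP[i6 ik].
by rewrite coframe_frame // (negbTE ik) mulr0.
Qed.

Lemma frame_metric_inj X Y :
  (forall Z, frame_metric X Z = frame_metric Y Z) -> X = Y.
Proof.
move=> XY; apply: (coframe_inj uP).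
by split; rewrite -!frame_metric_frame ?XY.
Qed.

(** * Existence and uniqueness of the Levi-Civita connection *)

Section LeviCivita.
Variable br : vec R -> vec R -> vec R.
Hypothesis Lbr : lie_bracket br.

Lemma lie_bracketC X Y : br X Y = - br Y X.
Proof.
have [brl brr br0 _] := Lbr; apply/eqP; rewrite -addr_eq0.
(* Polarisation of [br X X = 0]; the factor 1 gives the sum the shape in which linearity is
   assumed. *)
have := br0 (1 *: X + Y); rewrite brl !brr !br0 !scale1r addr0 add0r => h.
by apply/eqP.
Qed.

(** Torsion-freeness turns the three brackets into six covariant derivatives, and three instances of
    metric compatibility reduce these to twice the left side. Hence [nabla] is determined by the
    metric and the bracket. *)
Lemma koszul_formula nabla X Y Z :
  levi_civita br frame_metric nabla ->
  frame_metric (nabla X Y) Z =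
    2^-1 * (frame_metric (br X Y) Z - frame_metric (br Y Z) X
            + frame_metric (br Z X) Y).
Proof.
move=> [_ _ tor met]; rewrite -!tor !frame_metricBl.
have := met X Y Z; have := met Y X Z; have := met Z X Y.
rewrite !(frame_metricC _ (nabla _ _)).
by move=> h1 h2 h3; lra.
Qed.

(** The vector representing the Koszul functional: in an orthonormal frame its coordinates are the
    values of that functional on the frame. *)
Definition koszul (X Y : vec R) : vec R :=
  \sum_(1 <= k < 6)
    (2^-1 * (frame_metric (br X Y) (frame k) - frame_metric (br Y (frame k)) X
             + frame_metric (br (frame k) X) Y)) *: frame k.

Lemma frame_metric_koszul X Y Z :
  frame_metric (koszul X Y) Z =
    2^-1 * (frame_metric (br X Y) Z - frame_metric (br Y Z) X
            + frame_metric (br Z X) Y).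
Proof.
have [brl brr _ _] := Lbr.
pose f Z : R^o := 2^-1 * (frame_metric (br X Y) Z - frame_metric (br Y Z) X
                  + frame_metric (br Z X) Y).
have flin : linear f.
  move=> a U V; rewrite /f brl brr !frame_metricDl frame_metricDr /GRing.scale /=.
  by ring.
rewrite -[RHS]/(f Z) (linear_frame Z flin) /koszul.
have gl : linear (frame_metric^~ Z : vec R -> R^o).
  by move=> a U V; apply: frame_metricDl.
pose G : {linear vec R -> R^o} :=
  HB.pack (frame_metric^~ Z : vec R -> R^o)
    (GRing.isLinear.Build R (vec R) R^o *:%R _ gl).
rewrite -[LHS]/(G _) linear_sum big_seq [RHS]big_seq; apply: eq_bigr => k.
rewrite mem_index_iota => k6.
rewrite linearZ /= (frame_metricC (frame k)) /f !frame_metric_frame //.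
exact: mulrC.
Qed.

Lemma levi_civita_koszul : levi_civita br frame_metric koszul.
Proof.
have [brl brr br0 _] := Lbr.
split=> [a X Y Z|a X Y Z|X Y|X Y Z].
- apply: frame_metric_inj => W; rewrite frame_metricDl !frame_metric_koszul.
  by rewrite !(brl, brr) !(frame_metricDl, frame_metricDr); ring.
- apply: frame_metric_inj => W; rewrite frame_metricDl !frame_metric_koszul.
  by rewrite !(brl, brr) !(frame_metricDl, frame_metricDr); ring.
- apply: frame_metric_inj => W; rewrite frame_metricBl !frame_metric_koszul.
  (* Antisymmetry brings opposite brackets to one orientation, so that only linear arithmetic in the
     products remains. *)
  rewrite (lie_bracketC Y X) (lie_bracketC Y W) (lie_bracketC W X).
  by rewrite !frame_metricNl; lra.
- rewrite (frame_metricC Y) !frame_metric_koszul.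
  rewrite (lie_bracketC Z Y) (lie_bracketC Y X) (lie_bracketC X Z).
  by rewrite !frame_metricNl; lra.
Qed.

(** * The Ricci tensor in a frame *)

Section Ricci.
Variable nabla : vec R -> vec R -> vec R.
Hypothesis LC : levi_civita br frame_metric nabla.

Lemma ricciE X Y :
  ricci br nabla X Y =
    \sum_(1 <= k < 6) (coframe P k (curvature br nabla (frame k) X Y) : R).
Proof.
have [brl _ _ _] := Lbr; have [nl nr _ _] := LC.
apply: trace_frame => a U V.
rewrite /curvature !(brl, nl, nr) !scalerBr.
by apply/rowP => i; rewrite !mxE; ring.
Qed.

Lemma ricci_linearl Y : linear (fun X => ricci br nabla X Y : R^o).
Proof.
have [_ brr _ _] := Lbr; have [nl nr _ _] := LC => a U V.
rewrite !ricciE /GRing.scale /= mulr_sumr -big_split; apply: eq_bigr => k _ /=.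
rewrite -coframe_linear -coframe_linear; congr coframe.
rewrite /curvature !(brr, nl, nr) !scalerBr.
by apply/rowP => i; rewrite !mxE; ring.
Qed.

Lemma ricci_linearr X : linear (ricci br nabla X : vec R -> R^o).
Proof.
have [nl nr _ _] := LC => a U V.
rewrite !ricciE /GRing.scale /= mulr_sumr -big_split; apply: eq_bigr => k _ /=.
rewrite -coframe_linear -coframe_linear; congr coframe.
rewrite /curvature !(nl, nr) !scalerBr.
by apply/rowP => i; rewrite !mxE; ring.
Qed.

(** The three products come from the three terms of the curvature of [(e_k, e_i)] applied to [e_j]:
    the inner derivative or bracket is expanded in the frame with index [l], and [k] is the trace
    index. *)
Lemma ricci_frame i j :
  ricci br nabla (frame i) (frame j) =
    \sum_(1 <= k < 6) \sum_(1 <= l < 6)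
      ((coframe P l (nabla (frame i) (frame j)) : R)
         * coframe P k (nabla (frame k) (frame l))
       - (coframe P l (nabla (frame k) (frame j)) : R)
         * coframe P k (nabla (frame i) (frame l))
       - (coframe P l (br (frame k) (frame i)) : R)
         * coframe P k (nabla (frame l) (frame j))).
Proof.
have [nl nr _ _] := LC.
have expandr k X Y : coframe P k (nabla X Y) =
    \sum_(1 <= l < 6) (coframe P l Y : R) * coframe P k (nabla X (frame l)).
  apply: (linear_frame (V := R^o) (f := fun Y => coframe P k (nabla X Y))).
  by move=> a U V; rewrite nr !coframe_linear.
have expandl k X Y : coframe P k (nabla X Y) =
    \sum_(1 <= l < 6) (coframe P l X : R) * coframe P k (nabla (frame l) Y).
  apply: (linear_frame (V := R^o) (f := fun X => coframe P k (nabla X Y))).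
  by move=> a U V; rewrite nl !coframe_linear.
rewrite ricciE; apply: eq_bigr => k _.
rewrite !sumrB -expandr -expandr -expandl /curvature -!scaleN1r.
by rewrite !coframe_linear !mulN1r.
Qed.

Lemma christoffel i j k :
  (0 < i < 6)%N -> (0 < j < 6)%N -> (0 < k < 6)%N ->
  coframe P k (nabla (frame i) (frame j)) =
    2^-1 * ((coframe P k (br (frame i) (frame j)) : R)
            - coframe P i (br (frame j) (frame k))
            + coframe P j (br (frame k) (frame i))) :> R.
Proof.
by move=> i6 j6 k6; rewrite -!frame_metric_frame // (koszul_formula _ _ _ LC).
Qed.

Lemma eta_einstein_frame tau nu :
  (forall i j, (0 < i < 6)%N -> (0 < j < 6)%N ->
     ricci br nabla (frame i) (frame j)
       = tau * frame_metric (frame i) (frame j)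
         + nu * (coframe P 5 (frame i) * coframe P 5 (frame j))) ->
  forall X Y, ricci br nabla X Y
    = tau * frame_metric X Y + nu * (coframe P 5 X * coframe P 5 Y).
Proof.
move=> ric X Y.
pose B X Y : R^o := tau * frame_metric X Y + nu * (coframe P 5 X * coframe P 5 Y).
have Bl Z : linear (B^~ Z).
  by move=> a U V; rewrite /B frame_metricDl !coframe_linear /GRing.scale /=; ring.
have Br Z : linear (B Z).
  by move=> a U V; rewrite /B frame_metricDr !coframe_linear /GRing.scale /=; ring.
apply: (linear_frame_eq (f := fun X => ricci br nabla X Y : R^o) _ (Bl Y)).
  exact: ricci_linearl.
move=> i i6.
apply: (linear_frame_eq (f := ricci br nabla (frame i) : vec R -> R^o) _ (Br _)).
  exact: ricci_linearr.
by move=> j j6; rewrite ric.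
Qed.

End Ricci.
End LeviCivita.
End Frame.

(** * Independence of the associated metric from the adapted coframe *)

Section AssociatedMetric.
Variable R : realType.

(* A basis matrix with 1-based indices, as for coframes. *)
Definition unit_mx (u v : nat) : 'M[R]_5 := delta_mx (inord u.-1) (inord v.-1).

(* The matrix of e^{uv} + e^{wz} + eta^2; adding eta^2 makes omega_1, omega_2,
   omega_3 invertible. *)
Definition su2_mx (u v w z : nat) : 'M[R]_5 :=
  unit_mx u v - unit_mx v u + unit_mx w z - unit_mx z w + unit_mx 5 5.

Lemma su2_mx_form (P : 'M[R]_5) u v w z X Y :
  (X *m (P *m su2_mx u v w z *m P^T) *m Y^T) 0 0 =
    (ee P u v X Y : R) + ee P w z X Y + (coframe P 5 X : R) * coframe P 5 Y.
Proof.
have unitE i j : (X *m (P *m unit_mx i j *m P^T) *m Y^T) 0 0 =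
    (coframe P i X : R) * coframe P j Y.
  (* A basis matrix is a column times a row, which splits the bilinear form into a product of two
     coordinates. *)
  rewrite !mulmxA -(mulmxA _ P^T) -trmx_mul /unit_mx -(mul_delta_mx (0 : 'I_1)).
  rewrite mulmxA -(mulmxA _ _ (Y *m P)^T) -colE -rowE mxE big_ord1.
  by rewrite [col _ _ _ _]mxE [row _ _ _ _]mxE [_^T _ _]mxE.
rewrite /su2_mx !(mulmxDr, mulmxDl, mulmxN, mulNmx).
have entryD (A B : 'M[R]_1) : (A + B) 0 0 = A 0 0 + B 0 0 by rewrite mxE.
have entryN (A : 'M[R]_1) : (- A) 0 0 = - A 0 0 by rewrite mxE.
by rewrite !(entryD, entryN) !unitE !(two_formE P); ring.
Qed.

Lemma unit_mxM i j k l : (0 < j < 6)%N -> (0 < k < 6)%N ->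
  unit_mx i j *m unit_mx k l = unit_mx i l *+ (j == k).
Proof.
case: j k => [//|j] [//|k] /= j5 k5.
by rewrite /unit_mx mul_delta_mx_cond -val_eqE /= !inordK.
Qed.

Lemma sum_unit_mx : \sum_(1 <= i < 6) unit_mx i i = 1%:M.
Proof.
rewrite mx1_sum_delta big_add1 big_mkord; apply: eq_bigr => i _.
by rewrite /unit_mx /= inord_val.
Qed.

Lemma trmx_su2_mx u v w z : (su2_mx u v w z)^T = su2_mx v u z w.
Proof. by rewrite /su2_mx !linearD !linearN /= /unit_mx !trmx_delta. Qed.

(** The quaternion relation among the three 2-forms on the first four directions; on the fifth all
    the matrices act as the identity. *)
Lemma su2_mx_mul : su2_mx 1 2 3 4 *m (su2_mx 1 3 4 2)^T = su2_mx 1 4 2 3.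
Proof.
rewrite trmx_su2_mx /su2_mx !(mulmxDl, mulmxDr, mulmxN, mulNmx) !unit_mxM //=.
rewrite !mulr0n !mulr1n.
by apply/matrixP => i j; rewrite !mxE; ring.
Qed.

Lemma su2_mx2_orthogonal : su2_mx 1 3 4 2 *m (su2_mx 1 3 4 2)^T = 1%:M.
Proof.
rewrite trmx_su2_mx /su2_mx !(mulmxDl, mulmxDr, mulmxN, mulNmx) !unit_mxM //=.
rewrite !mulr0n !mulr1n -sum_unit_mx 5?big_ltn // big_geq //.
by apply/matrixP => i j; rewrite !mxE; ring.
Qed.

Lemma su2_mx3_orthogonal : su2_mx 1 4 2 3 *m (su2_mx 1 4 2 3)^T = 1%:M.
Proof.
rewrite trmx_su2_mx /su2_mx !(mulmxDl, mulmxDr, mulmxN, mulNmx) !unit_mxM //=.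
rewrite !mulr0n !mulr1n -sum_unit_mx 5?big_ltn // big_geq //.
by apply/matrixP => i j; rewrite !mxE; ring.
Qed.

Lemma bilinear_mx_inj (A B : 'M[R]_5) :
  (forall X Y : vec R, (X *m A *m Y^T) 0 0 = (X *m B *m Y^T) 0 0) -> A = B.
Proof.
move=> AB; apply/matrixP => i j.
have entryE (M : 'M[R]_5) :
    ((delta_mx 0 i : vec R) *m M *m (delta_mx 0 j : vec R)^T) 0 0 = M i j.
  by rewrite trmx_delta -rowE -colE !mxE.
by have := AB (delta_mx 0 i) (delta_mx 0 j); rewrite !entryE.
Qed.

Lemma frame_metricE (P : 'M[R]_5) X Y :
  frame_metric P X Y = (X *m (P *m P^T) *m Y^T) 0 0.
Proof.
rewrite mulmxA -mulmxA -trmx_mul mxE /frame_metric big_add1 big_mkord.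
by apply: eq_bigr => i _; rewrite /coframe /= inord_val !mxE.
Qed.

(* The change of coframe A satisfies A J A^T = J for J = J_1, J_2, J_3, the
   matrices of the omega_i + eta^2.  As J_3 = J_1 J_2^T and J_2 is orthogonal, A
   commutes with J_3, and then A J_3 A^T = J_3 gives A A^T = 1. *)
Lemma adapted_frame_metric (P Q : 'M[R]_5) :
  P \in unitmx -> Q \in unitmx -> adapted_forms P = adapted_forms Q ->
  frame_metric P =2 frame_metric Q.
Proof.
move=> uP uQ [e5 w1 w2 w3] X Y; rewrite !frame_metricE; congr ((_ *m _ *m _) 0 0).
pose A := invmx Q *m P.
have PA : P = Q *m A by rewrite mulKVmx.
have stab (u v w z : nat) :
    (ee P u v + ee P w z : two_form R) = (ee Q u v + ee Q w z : two_form R) ->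
    A *m su2_mx u v w z *m A^T = su2_mx u v w z.
  move=> E.
  have eqPQ : P *m su2_mx u v w z *m P^T = Q *m su2_mx u v w z *m Q^T.
    apply: bilinear_mx_inj => U V; rewrite !su2_mx_form e5.
    by congr (_ + _); have := congr1 (fun w : two_form R => w U V) E.
  rewrite PA trmx_mul in eqPQ; apply: (can_inj (mulKmx uQ)).
  have uQT : Q^T \in unitmx by rewrite unitmx_tr.
  by apply: (can_inj (mulmxK uQT)); rewrite -eqPQ !mulmxA.
have {w1}S1 := stab _ _ _ _ w1.
have {w2}S2 := stab _ _ _ _ w2.
have {w3 stab}S3 := stab _ _ _ _ w3.
(* By [S2] and the orthogonality of [J_2], the matrix [J_2 A^T J_2^T] is a right inverse of [A],
   hence also a left inverse. *)
have AJ2 : A^T *m (su2_mx 1 3 4 2)^T *m A = (su2_mx 1 3 4 2)^T.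
  have J2V := su2_mx2_orthogonal.
  have : A *m (su2_mx 1 3 4 2 *m A^T *m (su2_mx 1 3 4 2)^T) = 1%:M.
    by rewrite !mulmxA S2.
  move=> /mulmx1C; rewrite -!mulmxA => h.
  have := congr1 (mulmx (su2_mx 1 3 4 2)^T) h.
  by rewrite mulmx1 (mulmxA _ (su2_mx 1 3 4 2)) (mulmx1C J2V) mul1mx.
(* In [A J_1 J_2^T] the last factor is replaced by [A^T J_2^T A], and [S1] then absorbs
   [A J_1 A^T]. *)
have comm : A *m su2_mx 1 4 2 3 = su2_mx 1 4 2 3 *m A.
  by rewrite -{1}su2_mx_mul -AJ2 !mulmxA S1 su2_mx_mul.
have AAT : A *m A^T = 1%:M.
  have J3V := su2_mx3_orthogonal.
  move: S3; rewrite comm -mulmxA => /(congr1 (mulmx (su2_mx 1 4 2 3)^T)).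
  by rewrite (mulmxA _ (su2_mx 1 4 2 3)) (mulmx1C J3V) mul1mx.
by rewrite PA trmx_mul mulmxA -(mulmxA Q) AAT mulmx1.
Qed.

End AssociatedMetric.

(** * The Ricci tensor as a polynomial in the structure constants *)

Section StructureConstants.
Variables (R : realType) (br : vec R -> vec R -> vec R) (P : 'M[R]_5)
   (nabla : vec R -> vec R -> vec R).
Hypotheses (Lbr : lie_bracket br) (uP : P \in unitmx)
  (LC : levi_civita br (frame_metric P) nabla).

(** One table [c1], ..., [c5] per component of the bracket matches the form of the structure
    equations. [gamma] is the Christoffel symbol given by Koszul's formula; [k.-1] passes from
    1-based indices to list positions. *)
Lemma ricci_structure (c1 c2 c3 c4 c5 : nat -> nat -> R) :
  let br_frame c k := forall i j, (0 < i < 6)%N -> (0 < j < 6)%N ->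
    coframe P k (br (frame P i) (frame P j)) = c i j :> R in
  br_frame c1 1%N -> br_frame c2 2%N -> br_frame c3 3%N -> br_frame c4 4%N ->
  br_frame c5 5%N ->
  forall i j, (0 < i < 6)%N -> (0 < j < 6)%N ->
  let c i j k := nth 0 [:: c1 i j; c2 i j; c3 i j; c4 i j; c5 i j] k.-1 in
  let gamma i j k := 2^-1 * (c i j k - c j k i + c k i j) in
  ricci br nabla (frame P i) (frame P j) =
    \sum_(1 <= k < 6) \sum_(1 <= l < 6)
      (gamma i j l * gamma k l k - gamma k j l * gamma i l k
       - c k i l * gamma l j k).
Proof.
move=> br_frame h1 h2 h3 h4 h5 i j i6 j6 c gamma.
have cE u v k : (0 < u < 6)%N -> (0 < v < 6)%N -> (0 < k < 6)%N ->
    coframe P k (br (frame P u) (frame P v)) = c u v k.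
  move=> u6 v6; case: k => [|[|[|[|[|[|]]]]]] // _.
  - exact: h1.
  - exact: h2.
  - exact: h3.
  - exact: h4.
  - exact: h5.
have gammaE u v k : (0 < u < 6)%N -> (0 < v < 6)%N -> (0 < k < 6)%N ->
    coframe P k (nabla (frame P u) (frame P v)) = gamma u v k.
  by move=> u6 v6 k6; rewrite (christoffel uP LC) // !cE.
rewrite (ricci_frame uP Lbr LC) big_seq [RHS]big_seq; apply: eq_bigr => k.
rewrite mem_index_iota => k6.
rewrite big_seq [RHS]big_seq; apply: eq_bigr => l.
rewrite mem_index_iota => l6.
by rewrite !gammaE // !cE.
Qed.
End StructureConstants.

(** On frame vectors the coordinates become Kronecker deltas. The resulting table is an existential
    variable filled by [reflexivity], so that it need not be written out for each family. *)
Ltac frame_constants uP E :=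
  let E' := fresh in
  match type of E with forall X Y, coframe ?P ?k (?br X Y) = _ =>
    let f := open_constr:(_) in
    assert (E' : forall i j, (0 < i < 6)%N -> (0 < j < 6)%N ->
      coframe P k (br (frame P i) (frame P j)) = f i j);
    [ let i := fresh in let j := fresh in let h := fresh in let h' := fresh in
      intros i j h h'; rewrite E ?(coframe_frame uP) //; reflexivity
    | cbv beta in E'; clear E; rename E' into E ]
  end.


Ltac compute_constants uP E1 E2 E3 E4 E5 P :=
  expand_bracket P E1; expand_bracket P E2; expand_bracket P E3;
  expand_bracket P E4; expand_bracket P E5;
  frame_constants uP E1; frame_constants uP E2; frame_constants uP E3;
  frame_constants uP E4; frame_constants uP E5.

(** * Ricci curvature of the six families *)

Section Families.
Variables (R : realType) (br : vec R -> vec R -> vec R) (P : 'M[R]_5).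
Variable nabla : vec R -> vec R -> vec R.
Hypotheses (Lbr : lie_bracket br) (uP : P \in unitmx).
Hypothesis LC : levi_civita br (frame_metric P) nabla.

(* Ric(e_4, e_4) - Ric(e_1, e_1) *)
Definition ricci_gap (F : hypo_family R) : R :=
  match F with
  | F1 r => 12 * r ^+ 2 + 9 * (r ^+ 2) ^+ 2
  | F2 _ => 0
  | F3 a r => 4 * (a ^+ 2 + r ^+ 2) + (a ^+ 2 + r ^+ 2) ^+ 2
  | F4 a b => 4 * (a ^+ 2 + b ^+ 2) + (a ^+ 2 + b ^+ 2) ^+ 2
  | F5 r => 2 * r ^+ 2 + (r ^+ 2 / 2) ^+ 2
  | F6 a r => 2 * ((r ^+ 2 + a ^+ 2) / r) ^+ 2
              + ((r ^+ 2 + a ^+ 2) ^+ 2 / (2 * r ^+ 2)) ^+ 2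
  end.

Lemma ricci_gapE F : admissible F -> structure_equations br P F ->
  ricci br nabla (frame P 4) (frame P 4) - ricci br nabla (frame P 1) (frame P 1)
    = ricci_gap F.
Proof.
by case: F => [r|r|a r|a b|r|a r] /= adm [] E1 E5 [] E2 E3 E4;
  (* (F3) gives [de^3] through [de^2], and (F2) gives [de^4] through [de^5]. *)
  rewrite ?E2 ?E5 in E3 E4; compute_constants uP E1 E2 E3 E4 E5 P;
  (* Unlocking the big operators lets the double sums and the deltas compute, leaving a rational
     identity in the parameters. *)
  rewrite !(ricci_structure Lbr uP LC E1 E2 E3 E4 E5) // unlock /=; field.
Qed.

Lemma ricci_F2 r : structure_equations br P (F2 r) ->
  forall i j, (0 < i < 6)%N -> (0 < j < 6)%N ->
    ricci br nabla (frame P i) (frame P j) =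
      (- 2 - 6 * r ^+ 2) * (i == j)%:R
      + (6 + 6 * r ^+ 2) * ((5 == i)%:R * (5 == j)%:R).
Proof.
move=> [] E1 E5 [] E2 E3; rewrite E5 => E4 i j i6 j6.
compute_constants uP E1 E2 E3 E4 E5 P.
rewrite (ricci_structure Lbr uP LC E1 E2 E3 E4 E5) // unlock.
case: i i6 => [|[|[|[|[|[|//]]]]]] // _;
  case: j j6 => [|[|[|[|[|[|//]]]]]] // _ /=; by field.
Qed.

End Families.

(** Outside (F2) every gap has the form [c * x + d * y ^+ 2] with [c > 0], [d >= 0] and [x] a square
    or a sum of two squares; a nonzero parameter makes [x] positive. *)
Lemma ricci_gap_eq0 (R : realType) (F : hypo_family R) :
  admissible F -> ricci_gap F = 0 -> (exists r, F = F2 r) \/ F = F4 0 0.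
Proof.
have gap_neq0 (c d x y : R) : 0 < c -> 0 <= d -> 0 < x -> c * x + d * y ^+ 2 != 0.
  move=> c0 d0 x0.
  by rewrite gt_eqF // ltr_wpDr ?mulr_gt0 // mulr_ge0 // sqr_ge0.
have sqr_gt0 (x : R) : x != 0 -> 0 < x ^+ 2.
  by move=> x0; rewrite exprn_even_gt0.
have sumsqr_gt0 (x y : R) : x != 0 -> 0 < x ^+ 2 + y ^+ 2.
  by move=> x0; rewrite ltr_wpDr ?sqr_ge0 ?sqr_gt0.
(* The goals now come in the order (F2), ..., (F6), (F1). *)
case: F => [r|r|a r|a b|r|a r] /= adm gap0; first 1 last.
- by left; exists r.
- have := gap_neq0 4 1 (a ^+ 2 + r ^+ 2) (a ^+ 2 + r ^+ 2).
  by rewrite mul1r gap0 eqxx addrC sumsqr_gt0 // ltr0n ler01 => /(_ isT isT isT).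
- right; have [->|a0] := eqVneq a 0; last first.
    have := gap_neq0 4 1 (a ^+ 2 + b ^+ 2) (a ^+ 2 + b ^+ 2).
    by rewrite mul1r gap0 eqxx sumsqr_gt0 // ltr0n ler01 => /(_ isT isT isT).
  have [->//|b0] := eqVneq b 0.
  have := gap_neq0 4 1 (a ^+ 2 + b ^+ 2) (a ^+ 2 + b ^+ 2).
  by rewrite mul1r gap0 eqxx addrC sumsqr_gt0 // ltr0n ler01 => /(_ isT isT isT).
- have := gap_neq0 2 1 (r ^+ 2) (r ^+ 2 / 2).
  by rewrite mul1r gap0 eqxx sqr_gt0 // ltr0n ler01 => /(_ isT isT isT).
- have := gap_neq0 2 1 (((r ^+ 2 + a ^+ 2) / r) ^+ 2)
            ((r ^+ 2 + a ^+ 2) ^+ 2 / (2 * r ^+ 2)).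
  rewrite mul1r gap0 eqxx sqr_gt0 ?ltr0n ?ler01 => [/(_ isT isT isT)//|].
  by rewrite mulf_neq0 ?invr_eq0 // gt_eqF // sumsqr_gt0.
- have := gap_neq0 12 9 (r ^+ 2) (r ^+ 2).
  by rewrite gap0 eqxx sqr_gt0 // ltr0n ler0n => /(_ isT isT isT).
Qed.

(** * From frame entries to the eta-Einstein condition and back *)

Section EtaEinstein.
Variables (R : realType) (br : vec R -> vec R -> vec R) (P : 'M[R]_5).
Hypotheses (Lbr : lie_bracket br) (uP : P \in unitmx).

(** The coframe [Q] defining the metric may differ from [P], but both give the same metric. As [eta]
    vanishes on the unit vectors [e_1] and [e_4], both Ricci entries equal [tau]. *)
Lemma eta_einstein_ricci14 : eta_einstein br (adapted_forms P) ->
  exists2 nabla, levi_civita br (frame_metric P) nabla &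
    ricci br nabla (frame P 4) (frame P 4) = ricci br nabla (frame P 1) (frame P 1).
Proof.
move=> [g [nabla [[Q [uQ PQ gE]] LC [tau [nu ric]]]]].
have gP : g = frame_metric P.
  apply/funext => X; apply/funext => Y.
  by rewrite gE (adapted_frame_metric uP uQ PQ).
exists nabla; first by rewrite -gP.
by rewrite !ric gP !frame_metric_frame //= !coframe_frame.
Qed.

Lemma frame_eta_einstein tau nu :
  (forall i j, (0 < i < 6)%N -> (0 < j < 6)%N ->
     ricci br (koszul P br) (frame P i) (frame P j)
       = tau * (i == j)%:R + nu * ((5 == i)%:R * (5 == j)%:R)) ->
  eta_einstein br (adapted_forms P).
Proof.
move=> ric; exists (frame_metric P), (koszul P br).
have LC := levi_civita_koszul uP Lbr.
split=> //; first by exists P.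
exists tau, nu; apply: (eta_einstein_frame uP Lbr LC) => i j i6 j6.
by rewrite ric // frame_metric_frame // !coframe_frame // eq_sym.
Qed.

End EtaEinstein.

Theorem proposition4p2 (R : realType) (br : 'rV[R]_5 -> 'rV[R]_5 -> 'rV[R]_5)
    (P : 'M[R]_5) (F : hypo_family R) :
  lie_bracket br -> P \in unitmx ->
  admissible F -> structure_equations br P F ->
  (eta_einstein br (adapted_forms P) <->
     (exists r : R, F = F2 r) \/ F = F4 0 0).
Proof.
move=> Lbr uP adm eqF; split.
  case/(eta_einstein_ricci14 uP) => nabla LC ric14.
  apply: (ricci_gap_eq0 adm).
  by rewrite -(ricci_gapE Lbr uP LC adm eqF) ric14 subrr.
have einstein r : structure_equations br P (F2 r) ->
    eta_einstein br (adapted_forms P).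
  move=> eqr; have LC := levi_civita_koszul uP Lbr.
  exact: (frame_eta_einstein Lbr uP (ricci_F2 Lbr uP LC eqr)).
case=> [[r FE]|FE]; rewrite FE in eqF; first exact: (einstein _ eqF).
(* [einstein] also covers the value 0, at which the terms that distinguish the two families
   vanish. *)
apply: (einstein 0); case: eqF => E1 E5 [] E2 E3 E4; split=> //; split.
- by rewrite E2 expr0n /= !mulr0 !scale0r !addr0.
- by rewrite E3 expr0n /= !mulr0 addr0 !scale0r !addr0 !subr0.
- by rewrite E4 expr0n /= addr0 !oppr0 !scale0r !addr0 !subr0.
Qed.
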